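(* Let $A$ be a (random) real $N\times N$ symmetric positive definite matrix and $C$ a random vector in $\mathbb{R}^N$, and assume that the entries of $C$ and the upper triangular entries of $A$ are stochastically independent and each of them is non-singular. Let $q\le N$ and let $\lambda_1,\ldots,\lambda_q\in\mathbb{C}$ be distinct complex numbers. Then the vectors $$\{(A+\lambda_j\mathbb{I})^{-1}C\}_{j=1,\ldots,q}$$ are linearly independent (in $\mathbb{C}^N$) almost surely.
   Context: $\mathbb{I}$ is the $N\times N$ identity matrix. The upper triangular entries of $A$ are the entries $A_{ij}$ with $i\le j$ (diagonal included); independence means that all the upper triangular entries of $A$ and all entries of $C$ together form an independent family of random variables. A real random variable $X$ is called non-singular if $\mathbb{P}(X=a)=0$ for every $a\in\mathbb{R}$. The assertion includes that each $A+\lambda_j\mathbb{I}$ is almost surely invertible, so that the vectors are defined. *)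

(* Defs.v *)
From HB Require Import structures.
From mathcomp Require Export all_boot all_order all_algebra.
From mathcomp Require Export all_classical all_reals all_analysis.
From mathcomp Require Export complex.

Set Implicit Arguments.
Unset Strict Implicit.
Unset Printing Implicit Defensive.

Import Order.TTheory GRing.Theory Num.Theory.

Local Open Scope classical_set_scope.
Local Open Scope ring_scope.

Definition mutually_independent (d : measure_display) (T : measurableType d)
    (R : realType) (P : probability T R) (I : finType) (X : I -> T -> R) : Prop :=
  forall (J : {set I}) (B : I -> set R),
    (forall i, i \in J -> measurable (B i)) ->
    P (\bigcap_(i in [set` J]) (X i @^-1` B i)) =
    (\prod_(i in J) P (X i @^-1` B i))%E.

Definition non_singular (d : measure_display) (T : measurableType d)
    (R : realType) (P : probability T R) (X : T -> R) : Prop :=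
  forall a : R, P (X @^-1` [set a]) = 0%E.

Definition sym_pos_def (R : realType) (N : nat) (M : 'M[R]_N) : Prop :=
  M^T = M /\ forall x : 'cV[R]_N, x != 0 -> 0 < (x^T *m M *m x) 0 0.

Definition upper_index (N : nat) : finType :=
  {p : 'I_N * 'I_N | (p.1 <= p.2)%N}.

(* The joint family of the upper triangular entries of A (left summand) and
   the entries of C (right summand). *)
Definition entries (T : Type) (R : realType) (N : nat) (A : T -> 'M[R]_N)
    (C : T -> 'cV[R]_N) (k : upper_index N + 'I_N) (w : T) : R :=
  match k with
  | inl p => A w (val p).1 (val p).2
  | inr i => C w i 0
  end.

Definition complex_mx (R : realType) (m n : nat) (M : 'M[R]_(m, n)) :
    'M[R[i]]_(m, n) :=
  map_mx (real_complex R) M.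

Definition shifted (R : realType) (N : nat) (M : 'M[R]_N) (l : R[i]) :
    'M[R[i]]_N :=
  complex_mx M + l%:M.

(* Main.v *)
Require Import Defs.
From mathcomp Require Import all_boot all_order all_algebra.
From mathcomp Require Import all_classical all_reals all_analysis.
From mathcomp Require Import complex.
From mathcomp Require Import measurable_realfun polyrcf ring lra.

(* A polynomial that is not identically zero almost surely does not vanish at
   independent non-singular random variables (Fubini, one variable at a time).
   It is applied to two polynomials in the entries of A and C. The first is the
   determinant of the Krylov matrix [C, AC, ..., A^(N-1) C], which is a nonzero
   Vandermonde determinant when A is diagonal with distinct entries and C is the
   all-ones vector; a relation between the vectors (A + lambda_j)^-1 C amounts to
   p(A) C = 0 with deg p < N, so it is trivial once this determinant is nonzero.
   The second, which gives invertibility, is the real polynomial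
   |det (A + lambda_j)|^2 = det (A^2 + 2 Re(lambda_j) A + |lambda_j|^2). *)

Set Implicit Arguments.
Unset Strict Implicit.

Local Open Scope classical_set_scope.
Local Open Scope ring_scope.

Import Order.TTheory GRing.Theory Num.Theory.

(** * Null events for independent and for non-singular variables *)

(** Independence makes the joint law of [(Y, X)] the product of the marginal laws, so the
    probability of [G] is the integral over [s] of the probabilities of its sections, all zero. *)
Lemma independent_section_null (d d' : measure_display) (T : measurableType d)
    (S : measurableType d') (R : realType) (P : probability T R)
    (Y : T -> S) (X : T -> R) (G : set (S * R)) :
  measurable_fun setT Y -> measurable_fun setT X ->
  (forall B E, measurable B -> measurable E ->
    P (Y @^-1` B `&` X @^-1` E) = (P (Y @^-1` B) * P (X @^-1` E))%E) ->
  measurable G ->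
  (forall s, P (X @^-1` [set t | G (s, t)]) = 0%E) ->
  P [set w | G (Y w, X w)] = 0%E.
Proof.
move=> mY mX indYX mG G0.
pose Yf : {mfun T >-> S} := mfun_Sub (mem_set mY).
pose Xf : {mfun T >-> R} := mfun_Sub (mem_set mX).
pose YXf : {mfun T >-> (S * R)%type} :=
  mfun_Sub (mem_set (measurable_fun_pair mY mX)).
have joint : forall B E, measurable B -> measurable E ->
    distribution P YXf (B `*` E) = (distribution P Yf B * distribution P Xf E)%E.
  by move=> B E mB mE; rewrite -indYX.
rewrite -[LHS]/(distribution P YXf G).
rewrite -(product_measure_unique joint mG) [LHS]integral0_eq// => s _ /=.
rewrite -[RHS](G0 s) /distribution /pushforward/=; congr (P (X @^-1` _)).
by rewrite xsectionE.
Qed.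

(** To be applied to the finite set of real roots of a nonzero polynomial. *)
Lemma non_singular_finite (d : measure_display) (T : measurableType d)
    (R : realType) (P : probability T R) (X : T -> R) (s : seq R) :
  measurable_fun setT X -> non_singular P X -> P (X @^-1` [set` s]) = 0%E.
Proof.
move=> mX nsX.
have mXs B : measurable B -> measurable (X @^-1` B).
  by move=> mB; rewrite -[X in measurable X]setTI; exact: mX.
elim: s => [|x s IHs]; first by rewrite set_nil preimage_set0 measure0.
have -> : [set` x :: s] = [set x] `|` [set` s].
  apply/seteqP; split=> [y /=|y [->|]/=]; rewrite inE ?eqxx//.
    by case/orP=> [/eqP|]; [left|right].
  by move=> ->; rewrite orbT.
have mfin (s' : seq R) : measurable [set` s'].
  by apply: countable_measurable => [t|]; [exact: measurable_set1|
    exact/finite_set_countable/finite_seq].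
rewrite preimage_setU measureU0//; first exact: nsX.
- by rewrite -set_cons1; exact: mXs.
- exact: mXs.
Qed.

(** * Independence of one coordinate from the sigma-algebra of the others *)

Section independence.
Context (d : measure_display) (T : measurableType d) (R : realType).
Context (P : probability T R) (I : finType) (X : I -> T -> R).
Hypothesis mX : forall i, measurable_fun setT (X i).
Hypothesis indX : mutually_independent P X.

(** A pi-system generating the sigma-algebra of the coordinates in [J]. Measurability is asked at
    every index, so that two rectangles intersect coordinatewise. *)
Definition rectangles (J : {set I}) : set (set T) :=
  [set D | exists2 B : I -> set R, forall i, measurable (B i)
    & D = \bigcap_(i in [set` J]) (X i @^-1` B i)].

Lemma measurable_preimage (i : I) (B : set R) :
  measurable B -> measurable (X i @^-1` B).
Proof. by move=> mB; rewrite -[X in measurable X]setTI; exact: mX. Qed.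

Lemma rectangles_measurable (J : {set I}) : rectangles J `<=` measurable.
Proof.
move=> _ [B mB ->]; apply: fin_bigcap_measurable => [|i _].
  exact: finite_finset.
exact: measurable_preimage.
Qed.

(** Both sides are finite measures in [D]; they agree on the pi-system of rectangles, hence on the
    sigma-algebra it generates. *)
Lemma rectangles_independent (J : {set I}) (k : I) (D : set T) (E : set R) :
  k \notin J -> <<s rectangles J >> D -> measurable E ->
  P (D `&` X k @^-1` E) = (P D * P (X k @^-1` E))%E.
Proof.
move=> kJ sD mE; have mXE := measurable_preimage k mE.
have pE0 : 0 <= fine (P (X k @^-1` E)) by apply: fine_ge0.
suff: mrestr P mXE D = mscale (NngNum pE0) P D.
  by rewrite /mrestr /mscale /= muleC fineK// fin_num_measure.
apply: (g_sigma_algebra_measure_unique (rectangles J) _ (fun=> setT)) => //.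
- exact: rectangles_measurable.
- by move=> _; exists (fun=> setT) => //; apply/seteqP; split=> // w _ i _.
- by apply/seteqP; split => // x _; exists 0%N.
- move=> _ _ [B mB ->] [B' mB' ->]; exists (fun i => B i `&` B' i).
    by move=> i; exact: measurableI.
  by rewrite -bigcapI.
- move=> _ [B mB ->].
  (* Intersecting a rectangle over [J] with the event on [X k] gives a rectangle over [k |: J]; the
     product formula is used for both index sets. *)
  pose B' i := if i == k then E else B i.
  have mB' i : measurable (B' i) by rewrite /B'; case: eqP.
  have := indX (J := k |: J) (B := B') (fun i _ => mB' i).
  rewrite big_setU1//= {2}/B' eqxx => indk.
  rewrite /mrestr /mscale /= fineK ?fin_num_measure// muleC.
  have -> : \bigcap_(i in [set` J]) (X i @^-1` B i) =
            \bigcap_(i in [set` J]) (X i @^-1` B' i).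
    apply: eq_bigcapr => i /= iJ; rewrite /B'; case: eqP => // ik.
    by rewrite -ik iJ in kJ.
  rewrite (indX (J := J))// muleC -indk; congr (P _).
  apply/seteqP; split=> [w [wJ wk] i /=|w wJ].
    rewrite !inE => /orP[/eqP ->|iJ]; first by rewrite /B' eqxx.
    exact: wJ.
  split=> [i /= iJ|]; first by apply: wJ => /=; rewrite !inE iJ orbT.
  by have := wJ k; rewrite /= !inE eqxx /B' eqxx /=; apply.
- by move=> _; rewrite /= /mrestr setTI ltey_eq fin_num_measure.
Qed.

Lemma measurable_fun_rectangles (J : {set I}) (i : I) : i \in J ->
  measurable_fun setT (X i : g_sigma_algebraType (rectangles J) -> R).
Proof.
move=> iJ _ E mE; rewrite setTI; apply: sub_sigma_algebra.
exists (fun j => if j == i then E else setT) => [j|]; first by case: eqP.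
apply/seteqP; split=> [w wE j _ /=|w wJ]; first by case: eqP => // ->.
by have := wJ i iJ; rewrite /= eqxx.
Qed.

End independence.

(** * Polynomial functions of independent variables *)

(** Multivariate polynomials seen as functions: measurability and the restriction to one variable
    both follow by induction on the construction. *)
Inductive polyfun (K : Type) (R : pzRingType) : ((K -> R) -> R) -> Prop :=
| polyfun_cst c : polyfun (fun=> c)
| polyfun_var k : polyfun (fun x => x k)
| polyfunD f g : polyfun f -> polyfun g -> polyfun (fun x => f x + g x)
| polyfunM f g : polyfun f -> polyfun g -> polyfun (fun x => f x * g x).

Lemma polyfun_measurable (K : Type) (R : realType) (f : (K -> R) -> R)
    (d : measure_display) (S : measurableType d) (x : K -> S -> R) :
  polyfun f -> (forall k, measurable_fun setT (x k)) ->
  measurable_fun setT (fun s => f (fun k => x k s)).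
Proof.
move=> pf mx; elim: pf => [c|k|g h _ mg _ mh|g h _ mg _ mh] //.
- exact: measurable_funD.
- exact: measurable_funM.
Qed.

Definition update (K : eqType) (R : Type) (x : K -> R) (k : K) (t : R) :
    K -> R :=
  fun i => if i == k then t else x i.

Lemma polyfun_update (K : eqType) (R : comNzRingType) (f : (K -> R) -> R)
    (x : K -> R) (k : K) :
  polyfun f -> exists p : {poly R}, forall t, f (update x k t) = p.[t].
Proof.
elim=> [c|i|g h _ [p pE] _ [q qE]|g h _ [p pE] _ [q qE]].
- by exists c%:P => t; rewrite hornerC.
- exists (if i == k then 'X else (x i)%:P) => t; rewrite /update.
  by case: eqP; rewrite (hornerX, hornerC).
- by exists (p + q) => t; rewrite hornerD pE qE.
- by exists (p * q) => t; rewrite hornerM pE qE.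
Qed.

(* The coordinates of a point where f does not vanish are replaced one at a
   time by the random ones; at each replacement f is a nonzero polynomial in the
   new coordinate, which is independent of the previous ones. *)
Lemma polyfun_null (d : measure_display) (T : measurableType d) (R : realType)
    (P : probability T R) (I : finType) (X : I -> T -> R)
    (f : (I -> R) -> R) (a : I -> R) :
  (forall i, measurable_fun setT (X i)) -> mutually_independent P X ->
  (forall i, non_singular P (X i)) -> polyfun f -> f a != 0 ->
  P [set w | f (X^~ w) = 0] = 0%E.
Proof.
move=> mX indX nsX pf fa0.
pose hyb (J : {set I}) i : T -> R := if i \in J then X i else cst (a i).
suff null (s : seq I) : P [set w | f ((hyb [set i in s])^~ w) = 0] = 0%E.
  rewrite -[RHS](null (enum I)); congr (P _); apply/seteqP.
  have hybE w : (hyb [set i in enum I])^~ w = X^~ w.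
    by apply/funext => i; rewrite /hyb inE mem_enum.
  by split=> w /=; rewrite hybE.
elim: s => [|k s IHs].
  rewrite [X in P X](_ : _ = set0) ?measure0// -subset0 => w /=.
  rewrite [X in f X](_ : _ = a); first by move/eqP: fa0.
  by apply/funext => i; rewrite /hyb inE.
pose J := [set i in s].
have [kJ|kJ] := boolP (k \in J).
  rewrite [X in hyb X](_ : _ = J)//; apply/setP => i.
  by move: kJ; rewrite !inE; case: eqP => // ->.
have hybE w : (hyb [set i in k :: s])^~ w = update ((hyb J)^~ w) k (X k w).
  apply/funext => i; rewrite /hyb /update !inE; case: eqP => [->|]//.
have mhyb (K : {set I}) d' (S : measurableType d') (Y : S -> T) :
    (forall i, i \in K -> measurable_fun setT (X i \o Y)) ->
    forall i, measurable_fun setT (hyb K i \o Y).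
  move=> mY i; rewrite /hyb; case: ifPn => iK; first exact: mY.
  exact: measurable_cst.
(* [S] is [T] with only the information of the coordinates already replaced; the identity from [T]
   to [S] is then a random variable independent of [X k]. *)
pose S := g_sigma_algebraType (rectangles X J).
(* The bad event: [f] is nonzero before coordinate [k] is replaced and zero afterwards. *)
pose G := [set u : S * R | f ((hyb J)^~ u.1) != 0] `&`
          [set u : S * R | f (update ((hyb J)^~ u.1) k u.2) = 0].
have mid : measurable_fun setT (id : T -> S).
  move=> _ B; rewrite setTI; apply: smallest_sub => //.
    exact: sigma_algebra_measurable.
  exact: rectangles_measurable.
have mS i : measurable_fun setT (hyb J i : S -> R).
  apply: (mhyb J _ S id) => {}i iJ; exact: measurable_fun_rectangles.
have mpre d' (U : measurableType d') (h : U -> R) B :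
    measurable_fun setT h -> measurable B -> measurable (h @^-1` B).
  by move=> mh mB; rewrite -[X in measurable X]setTI; exact: mh.
have mfst i : measurable_fun setT (fun u : S * R => hyb J i u.1).
  exact: (measurableT_comp (mS i) measurable_fst).
have mG : measurable G.
  apply: measurableI.
    apply: (mpre _ _ (fun u : S * R => f ((hyb J)^~ u.1)) [set x | x != 0]).
      exact: (polyfun_measurable (x := fun i (u : S * R) => hyb J i u.1)).
    rewrite [X in measurable X](_ : _ = ~` [set 0]).
      by apply: measurableC; exact: measurable_set1.
    by apply/seteqP; split=> x /= /eqP.
  apply: (mpre _ _ (fun u : S * R => f (update ((hyb J)^~ u.1) k u.2)) [set 0]).
    apply: (polyfun_measurable
      (x := fun i (u : S * R) => update ((hyb J)^~ u.1) k u.2 i)) => // i.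
    by rewrite /update; case: eqP => _; [exact: measurable_snd|exact: mfst].
  exact: measurable_set1.
have GX0 : P [set w | G (w, X k w)] = 0%E.
  apply: (independent_section_null mid (mX k) _ mG).
    move=> B E mB mE; exact: (rectangles_independent mX indX kJ mB mE).
  move=> w; have [fw0|fw0] := eqVneq (f ((hyb J)^~ w)) 0.
    rewrite [X in P X](_ : _ = set0) ?measure0// -subset0 => w' /=.
    by rewrite /G /= fw0 eqxx => -[].
  have [p pE] := polyfun_update ((hyb J)^~ w) k pf.
  (* The value of [p] at [a k] is the value of [f] before the replacement, since [k] outside [J]
     means that the hybrid point still has coordinate [a k]. *)
  have p0 : p != 0.
    apply: contraNneq fw0 => p0.
    rewrite -(_ : update ((hyb J)^~ w) k (a k) = (hyb J)^~ w).
      by rewrite pE p0 horner0.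
    apply/funext => i; rewrite /update /hyb; case: eqP => // ->.
    by rewrite (negbTE kJ).
  rewrite -[RHS](non_singular_finite (rootsR p) (mX k) (nsX k)).
  congr (P (_ @^-1` _)); apply/seteqP; split=> t /=.
    by rewrite /G/= pE -(roots_on_rootsR p0) => -[_ /eqP].
  by rewrite /G/= pE -(roots_on_rootsR p0) => /= /eqP.
have mZ (K : {set I}) : measurable [set w | f ((hyb K)^~ w) = 0].
  apply: (mpre _ _ (fun w => f ((hyb K)^~ w)) [set 0]).
    apply: (polyfun_measurable (x := hyb K)) => // i.
    exact: (mhyb K _ T id (fun i _ => mX i) i).
  exact: measurable_set1.
apply/negligibleP; first exact: mZ.
have /negligibleP nJ : P [set w | f ((hyb J)^~ w) = 0] = 0%E by [].
have /negligibleP nG := GX0.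
apply: negligibleS (negligibleU (nJ _) (nG _)); last 2 first.
- exact: mZ.
- rewrite (_ : [set w | _] = (fun w => (w : S, X k w)) @^-1` G)//.
  rewrite -[X in measurable X]setTI.
  by apply: (measurable_fun_pair mid (mX k)) mG.
(* A zero after the replacement was a zero before it or belongs to the bad event. *)
move=> w /=; rewrite hybE; have [fw0|fw0] := eqVneq (f ((hyb J)^~ w)) 0.
  by left.
by right; split.
Qed.

(** * Matrices with polynomial entries *)

Section polyfun_matrix.
Context (K : Type) (R : comNzRingType).
Local Notation polyfun := (@polyfun K R).

Lemma polyfun_sum (I : Type) (r : seq I) (Q : pred I)
    (f : I -> (K -> R) -> R) :
  (forall i, polyfun (f i)) -> polyfun (fun x => \sum_(i <- r | Q i) f i x).
Proof.
move=> pf; elim: r => [|i r IHr].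
  by under eq_fun do rewrite big_nil; exact: polyfun_cst.
under eq_fun do rewrite big_cons; case: (Q i) => //; exact: polyfunD.
Qed.

Lemma polyfun_prod (I : Type) (r : seq I) (Q : pred I)
    (f : I -> (K -> R) -> R) :
  (forall i, polyfun (f i)) -> polyfun (fun x => \prod_(i <- r | Q i) f i x).
Proof.
move=> pf; elim: r => [|i r IHr].
  by under eq_fun do rewrite big_nil; exact: polyfun_cst.
under eq_fun do rewrite big_cons; case: (Q i) => //; exact: polyfunM.
Qed.

Definition polymx (m n : nat) (F : (K -> R) -> 'M[R]_(m, n)) : Prop :=
  forall i j, polyfun (fun x => F x i j).

Lemma polymx_cst (m n : nat) (A : 'M[R]_(m, n)) : polymx (fun=> A).
Proof. by move=> i j; exact: polyfun_cst. Qed.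

Lemma polymxD (m n : nat) (F G : (K -> R) -> 'M[R]_(m, n)) :
  polymx F -> polymx G -> polymx (fun x => F x + G x).
Proof.
by move=> pF pG i j; under eq_fun do rewrite mxE; exact: polyfunD.
Qed.

Lemma polymxM (m n p : nat) (F : (K -> R) -> 'M[R]_(m, n))
    (G : (K -> R) -> 'M[R]_(n, p)) :
  polymx F -> polymx G -> polymx (fun x => F x *m G x).
Proof.
move=> pF pG i j; under eq_fun do rewrite mxE.
by apply: polyfun_sum => k; exact: polyfunM.
Qed.

Lemma polymxX (n k : nat) (F : (K -> R) -> 'M[R]_n) :
  polymx F -> polymx (fun x => F x ^+ k).
Proof.
move=> pF; elim: k => [|k IHk]; first exact: polymx_cst.
by under eq_fun do rewrite exprS; exact: polymxM.
Qed.

Lemma polyfun_det (n : nat) (F : (K -> R) -> 'M[R]_n) :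
  polymx F -> polyfun (fun x => \det (F x)).
Proof.
move=> pF; rewrite /determinant; apply: polyfun_sum => s.
apply: polyfunM; first exact: polyfun_cst.
by apply: polyfun_prod => i; exact: pF.
Qed.

End polyfun_matrix.

(** * Krylov matrices and freeness of resolvent vectors *)

Definition krylov (R : pzSemiRingType) (n : nat) (A : 'M[R]_n) (v : 'cV[R]_n) :
    'M[R]_n :=
  \matrix_(i, k) (A ^+ k *m v) i 0.

Lemma horner_mx_krylov (F : fieldType) (n : nat) (A : 'M[F]_n.+1)
    (v : 'cV[F]_n.+1) (p : {poly F}) : (size p <= n.+1)%N ->
  horner_mx A p *m v = krylov A v *m \col_i p`_i.
Proof.
move=> sp; apply/colP => i; rewrite -[in LHS](coefK p).
(* The coefficients are padded with zeros up to the number of columns. *)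
have -> : \poly_(k < size p) p`_k = \sum_(k < n.+1) p`_k *: 'X^k.
  by rewrite coefK -{1}(coefK p) -poly_def; apply/polyP => k; rewrite !coef_poly;
   case: ltnP => // kp; [rewrite (leq_trans kp)|rewrite nth_default// if_same].
rewrite linear_sum mulmx_suml summxE mxE; apply: eq_bigr => k _.
by rewrite linearZ rmorphXn/= horner_mx_X -scalemxAl !mxE mulrC.
Qed.

(* Clearing denominators turns a relation between the resolvents into p(A) v = 0
   with deg p < q <= n, and the Krylov matrix being invertible forces p = 0;
   evaluating p at -mu_j isolates the j-th coefficient. *)
Lemma krylov_free (F : fieldType) (n q : nat) (A : 'M[F]_n) (v : 'cV[F]_n)
    (mu : 'I_q -> F) :
  (q <= n)%N -> injective mu -> (forall j, A + (mu j)%:M \in unitmx) ->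
  krylov A v \in unitmx ->
  free [seq invmx (A + (mu j)%:M) *m v | j <- enum 'I_q].
Proof.
case: n A v => [|n] A v le_qn mu_inj uA uK.
  by case: q le_qn mu mu_inj uA => // _ mu _ _; rewrite enum_ord0 nil_free.
change (free (map_tuple (fun j => invmx (A + (mu j)%:M) *m v) (ord_tuple q))).
apply/freeP => c c0 j.
have {}c0 : \sum_i c i *: (invmx (A + (mu i)%:M) *m v) = 0.
  rewrite -[RHS]c0; apply: eq_bigr => i _.
  by rewrite -tnth_nth tnth_map tnth_ord_tuple.
pose L i : {poly F} := 'X + (mu i)%:P.
(* The numerator of the sum of the fractions [c i / L i] over the common denominator
   [\prod_i L i]. *)
pose p := \sum_i c i *: \prod_(k | k != i) L k.
have hL i : horner_mx A (L i) = A + (mu i)%:M.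
  by rewrite rmorphD/= horner_mx_X horner_mx_C.
have eL i x : (L i).[x] = x + mu i by rewrite hornerD hornerX hornerC.
have sL i : size (L i) = 2%N by rewrite /L size_XaddC.
have sp : (size p <= n.+1)%N.
  apply: leq_trans le_qn; apply: (leq_trans (size_sum _ _ _)).
  apply/bigmax_leqP => i _; apply: leq_trans (size_scale_leq _ _) _.
  apply: leq_trans (size_poly_prod_leq _ _) _.
  (* Each product has [q - 1] factors of degree one, hence size at most [q]. *)
  rewrite (eq_bigr (fun=> 2%N)) => [|k _]; last exact: sL.
  rewrite sum_nat_const cardC1 card_ord muln2 -addnn leq_subLR.
  by rewrite -addnS; case: (q) i => // -[].
have hp : horner_mx A p *m v = 0.
  (* Multiplying the relation [c0] by [Q] cancels each inverse against its own factor. *)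
  pose Q := horner_mx A (\prod_i L i).
  rewrite -[RHS](mulmx0 _ Q) -c0 mulmx_sumr linear_sum mulmx_suml.
  apply: eq_bigr => i _; rewrite linearZ/= -scalemxAl -scalemxAr mulmxA.
  congr (_ *: (_ *m _)); rewrite /Q [in RHS](bigD1 i)//= mulrC rmorphM/= hL.
  by rewrite -[RHS]mulmxA mulmxV ?mulmx1.
have p0 : p = 0.
  have : krylov A v *m \col_i p`_i = 0 by rewrite -horner_mx_krylov.
  move/(congr1 (mulmx (invmx (krylov A v)))); rewrite mulKmx// mulmx0.
  move=> /colP pi0.
  apply/polyP => i; rewrite coef0; case: (ltnP i n.+1) => [ltin|lein].
    by have := pi0 (Ordinal ltin); rewrite !mxE.
  by rewrite nth_default// (leq_trans sp).
have := congr1 (fun r => r.[- mu j]) p0; rewrite horner0 horner_sum.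
rewrite (bigD1 j)//= [X in _ + X]big1 => [|i ij]; last first.
  by rewrite hornerZ (bigD1 j) ?(eq_sym j)//= hornerM eL addNr mul0r mulr0.
rewrite addr0 hornerZ => /eqP; rewrite mulf_eq0 => /orP[/eqP//|].
rewrite horner_prod prodf_seq_eq0 => /hasP[i _ /andP[ij]].
by rewrite eL addrC subr_eq0 => /eqP/mu_inj ijE; rewrite ijE eqxx in ij.
Qed.

(** Carries the condition on the real Krylov determinant over to the complex matrix. *)
Lemma krylov_map (R S : pzSemiRingType) (f : {rmorphism R -> S}) (n : nat)
    (A : 'M[R]_n) (v : 'cV[R]_n) :
  krylov (map_mx f A) (map_mx f v) = map_mx f (krylov A v).
Proof.
have mapX k : map_mx f A ^+ k = map_mx f (A ^+ k).
  elim: k => [|k IHk]; first by rewrite !expr0 map_mx1.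
  by rewrite !exprS IHk map_mxM.
by apply/matrixP => i k; rewrite [LHS]mxE mapX -map_mxM !mxE.
Qed.

Lemma diag_mxX (R : pzSemiRingType) (n k : nat) (d : 'rV[R]_n) :
  diag_mx d ^+ k = diag_mx (\row_i d 0 i ^+ k).
Proof.
elim: k => [|k IHk].
  by rewrite expr0; apply/matrixP => i j; rewrite !mxE.
rewrite exprS IHk; apply: etrans (mulmx_diag _ _) _; congr diag_mx.
by apply/rowP => i; rewrite !mxE exprS.
Qed.

Lemma krylov_diag (R : comNzRingType) (n : nat) (d : 'rV[R]_n) :
  krylov (diag_mx d) (const_mx 1) = (Vandermonde n d)^T.
Proof.
by apply/matrixP => i k; rewrite mxE diag_mxX mul_diag_mx !mxE mulr1.
Qed.

(** * Matrix and vector rebuilt from the independent entries *)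

Section entries_matrix.
Context (R : comNzRingType) (N : nat).
Implicit Types x : upper_index N + 'I_N -> R.

Lemma upper_pair_subproof (i j : 'I_N) :
  let p := if (i <= j)%N then (i, j) else (j, i) in (p.1 <= p.2)%N.
Proof. by case: leqP => //= /ltnW. Qed.

(** Reflects positions below the diagonal, so that [entries_mx] is symmetric for every choice of
    coordinates. *)
Definition upper_pair (i j : 'I_N) : upper_index N :=
  exist (fun p : 'I_N * 'I_N => is_true (p.1 <= p.2)%N) _
    (upper_pair_subproof i j).

Definition entries_mx x : 'M[R]_N := \matrix_(i, j) x (inl (upper_pair i j)).

Definition entries_col x : 'cV[R]_N := \col_i x (inr i).

(** Coordinates of the test points: a diagonal matrix and the all-ones vector. *)
Definition diag_entries (a : 'I_N -> R) (k : upper_index N + 'I_N) : R :=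
  match k with
  | inl p => if (val p).1 == (val p).2 then a (val p).1 else 0
  | inr _ => 1
  end.

Lemma entries_mx_diag (a : 'I_N -> R) :
  entries_mx (diag_entries a) = diag_mx (\row_i a i).
Proof.
apply/matrixP => i j; rewrite !mxE/=; case: leqP => _ /=.
  by case: eqP.
by rewrite eq_sym; case: eqP => // ->.
Qed.

Lemma entries_col_diag (a : 'I_N -> R) :
  entries_col (diag_entries a) = const_mx 1.
Proof. by apply/colP => i; rewrite !mxE. Qed.

Lemma polymx_entries_mx : polymx entries_mx.
Proof. by move=> i j; under eq_fun do rewrite mxE; exact: polyfun_var. Qed.

Lemma polymx_entries_col : polymx entries_col.
Proof. by move=> i j; under eq_fun do rewrite mxE; exact: polyfun_var. Qed.

Lemma polyfun_krylov_det :
  polyfun (fun x => \det (krylov (entries_mx x) (entries_col x))).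
Proof.
apply: polyfun_det => i k; under eq_fun do rewrite mxE.
apply: polymxM; last exact: polymx_entries_col.
exact/polymxX/polymx_entries_mx.
Qed.

End entries_matrix.

Lemma entries_mxE (T : Type) (R : realType) (N : nat) (A : T -> 'M[R]_N)
    (C : T -> 'cV[R]_N) (w : T) :
  (A w)^T = A w -> entries_mx ((entries A C)^~ w) = A w.
Proof.
move=> symA; apply/matrixP => i j; rewrite mxE/=; case: leqP => //= _.
by rewrite -[in LHS]symA mxE.
Qed.

Lemma entries_colE (T : Type) (R : realType) (N : nat) (A : T -> 'M[R]_N)
    (C : T -> 'cV[R]_N) (w : T) :
  entries_col ((entries A C)^~ w) = C w.
Proof. by apply/colP => i; rewrite mxE. Qed.

(** * A real determinant for invertibility, and points where both polynomials are nonzero *)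

Definition shifted_norm (R : realType) (N : nat) (M : 'M[R]_N) (l : R[i]) :
    'M[R]_N :=
  M *m M + (2 * complex.Re l)%:M *m M +
  (complex.Re l ^+ 2 + complex.Im l ^+ 2)%:M.

Lemma shifted_normE (R : realType) (N : nat) (M : 'M[R]_N) (l : R[i]) :
  complex_mx (shifted_norm M l) = shifted M l *m shifted M (conjc l).
Proof.
rewrite /complex_mx /shifted_norm !map_mxD !map_mxM !map_scalar_mx/=.
rewrite /shifted /complex_mx mulmxDl !mulmxDr -!addrA; congr (_ + _).
rewrite addrA; congr (_ + _); last first.
  rewrite -scalar_mxM; congr (_ %:M); case: l => a b /=.
  by apply/eqP; rewrite eq_complex/=; apply/andP; split; apply/eqP; ring.
rewrite scalar_mxC -mulmxDl -raddfD; congr (_ %:M *m _).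
case: l => a b /=.
by apply/eqP; rewrite eq_complex/=; apply/andP; split; apply/eqP; ring.
Qed.

Lemma shifted_unit (R : realType) (N : nat) (M : 'M[R]_N) (l : R[i]) :
  \det (shifted_norm M l) != 0 -> shifted M l \in unitmx.
Proof.
move=> d0; have : complex_mx (shifted_norm M l) \in unitmx.
  by rewrite map_unitmx unitmxE unitfE.
by rewrite shifted_normE unitmx_mul => /andP[].
Qed.

Lemma polyfun_shifted_norm_det (R : realType) (N : nat) (l : R[i]) :
  polyfun (fun x : upper_index N + 'I_N -> R =>
    \det (shifted_norm (entries_mx x) l)).
Proof.
apply: polyfun_det; apply: polymxD; last exact: polymx_cst.
apply: polymxD; first by apply: polymxM; exact: polymx_entries_mx.
by apply: polymxM; [exact: polymx_cst|exact: polymx_entries_mx].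
Qed.

(** The diagonal entries 0, ..., N-1 are distinct in characteristic zero, so no Vandermonde factor
    vanishes. *)
Lemma krylov_det_neq0 (R : realType) (N : nat) :
  let a := diag_entries (fun i : 'I_N => (i : nat)%:R : R) in
  \det (krylov (entries_mx a) (entries_col a)) != 0.
Proof.
rewrite /= entries_mx_diag entries_col_diag krylov_diag det_tr det_Vandermonde.
apply/prodf_neq0 => i _; apply/prodf_neq0 => j ij.
by rewrite !mxE subr_eq0 eqr_nat neq_ltn ij orbT.
Qed.

(** At the scalar matrix [t] the determinant is the [N]-th power of [(t + Re l)^2 + (Im l)^2]; the
    choice of [t] makes [t + Re l] positive. *)
Lemma shifted_norm_det_neq0 (R : realType) (N : nat) (l : R[i]) :
  let a := diag_entries (fun _ : 'I_N => `|complex.Re l| + 1 : R) in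
  \det (shifted_norm (entries_mx a) l) != 0.
Proof.
set t := `|complex.Re l| + 1; rewrite /= entries_mx_diag.
have -> : diag_mx (\row_(i < N) t) = t%:M.
  by rewrite -diag_const_mx; congr diag_mx; apply/rowP => i; rewrite !mxE.
rewrite /shifted_norm -!scalar_mxM -!raddfD/= det_scalar expf_neq0// gt_eqF//.
have -> : t * t + 2 * complex.Re l * t +
    (complex.Re l ^+ 2 + complex.Im l ^+ 2) =
    (t + complex.Re l) ^+ 2 + complex.Im l ^+ 2 by ring.
rewrite ltr_pwDl ?sqr_ge0// exprn_gt0//.
by have := ler_norm (- complex.Re l); rewrite normrN /t; lra.
Qed.

Theorem lemma8p2 (d : measure_display) (T : measurableType d) (R : realType)
    (P : probability T R) (N q : nat)
    (A : T -> 'M[R]_N) (C : T -> 'cV[R]_N) (lambda : 'I_q -> R[i])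
    (measA : forall i j, measurable_fun setT (fun w => A w i j))
    (measC : forall i, measurable_fun setT (fun w => C w i 0))
    (spdA : {ae P, forall w, sym_pos_def (A w)})
    (indep : mutually_independent P (entries A C))
    (nonsing : forall k, non_singular P (entries A C k))
    (le_qN : (q <= N)%N)
    (lambda_inj : injective lambda) :
  {ae P, forall w,
    (forall j, shifted (A w) (lambda j) \in unitmx) /\
    free [seq invmx (shifted (A w) (lambda j)) *m complex_mx (C w)
         | j <- enum 'I_q]}.
Proof.
have mX k : measurable_fun setT (entries A C k).
  by case: k => [p|i]; [exact: measA|exact: measC].
pose X w k := entries A C k w.
have ae_neq0 f a : polyfun f -> f a != 0 -> {ae P, forall w, f (X w) != 0}.
  move=> pf fa; apply: (@negligibleS _ _ _ P [set w | f (X w) = 0]).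
    by move=> w /negP/negPn/eqP.
  apply/negligibleP; last exact: (polyfun_null mX indep nonsing pf fa).
  rewrite -[X in measurable X]setTI.
  have mfX := polyfun_measurable pf mX.
  by apply: (mfX measurableT [set 0]); exact: measurable_set1.
have ae_krylov := ae_neq0 _ _ (@polyfun_krylov_det _ N) (@krylov_det_neq0 R N).
have ae_unit j := ae_neq0 _ _ (@polyfun_shifted_norm_det _ N (lambda j))
  (@shifted_norm_det_neq0 R N (lambda j)).
have {}ae_unit : {ae P, forall w, forall j,
    \det (shifted_norm (entries_mx (X w)) (lambda j)) != 0}.
  exact: filter_forall.
(* On the intersection of the three almost sure events the argument is deterministic; symmetry of
   [A w] identifies it with the matrix rebuilt from its upper triangle. *)
apply: filterS3 spdA ae_unit ae_krylov => w [symA _].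
rewrite entries_mxE// entries_colE => uA uK.
have {}uA j : shifted (A w) (lambda j) \in unitmx by exact: shifted_unit.
split=> //; apply: krylov_free => //.
by rewrite krylov_map map_unitmx unitmxE unitfE.
Qed.
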